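(* For any $a,b\in\mathbb{N}_0$, $$t^{\star}(\{2\}^{a},3,\{2\}^{b})=-\frac{4}{\pi}t(\overline{2a+2b+4})-\frac{8}{\pi}t(\overline{2a+2},2b+2)=-\frac{4}{\pi}\sum_{r=1}^{a+b+1}2^{-2r}\left[\binom{2r}{2a+1}(1-2^{-2r})+\binom{2r}{2b+1}\right]\zeta(2r+1)\,t(\overline{2a+2b+3-2r}).$$
   Context: $t^{\star}(\boldsymbol{s})=\sum_{k_1\geq\cdots\geq k_r\geq1}\prod_{j}(2k_j-1)^{-s_j}$ for an index with $s_1>1$; $\{2\}^a$ is $2$ repeated $a$ times. Alternating multiple $t$-values: $t(\boldsymbol{s};\boldsymbol{\sigma})=\sum_{k_1>\cdots>k_r\geq1}\prod_{j}\frac{\sigma_j^{k_j}}{(2k_j-1)^{s_j}}$, where a bar over $s_j$ means $\sigma_j=-1$ and no bar means $\sigma_j=1$. $\zeta$ is the Riemann zeta function. *)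

(* Defs.v *)
From Stdlib Require Import Reals List.
From Coquelicot Require Import Coquelicot.
Import ListNotations.
Open Scope R_scope.

Fixpoint sum1 (f : nat -> R) (N : nat) : R :=
  match N with
  | O => 0
  | S n => sum1 f n + f (S n)
  end.

(* binomial coefficient, with binom n k = 0 when k > n *)
Fixpoint binom (n k : nat) : nat :=
  match n, k with
  | _, O => 1
  | O, S _ => 0
  | S n', S k' => (binom n' k' + binom n' (S k'))%nat
  end.

Definition oddinv (k s : nat) : R := / (INR (2 * k - 1)) ^ s.

(* truncated multiple t-star sum: N >= k_1 >= k_2 >= ... >= k_r >= 1 *)
Fixpoint tstar_trunc (s : list nat) (N : nat) : R :=
  match s with
  | [] => 1
  | s1 :: rest => sum1 (fun k => oddinv k s1 * tstar_trunc rest k) N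
  end.

Definition tstar (s : list nat) : R := real (Lim_seq (tstar_trunc s)).

(* alternating index: (s_j, bar_j); bar_j = true means sigma_j = -1 *)
Definition sgn (bar : bool) (k : nat) : R := if bar then (-1) ^ k else 1.

(* truncated alternating multiple t-sum: N >= k_1 > k_2 > ... > k_r >= 1 *)
Fixpoint talt_trunc (s : list (nat * bool)) (N : nat) : R :=
  match s with
  | [] => 1
  | (s1, b1) :: rest =>
      sum1 (fun k => sgn b1 k * oddinv k s1 * talt_trunc rest (k - 1)) N
  end.

Definition talt (s : list (nat * bool)) : R := real (Lim_seq (talt_trunc s)).

Definition zeta (s : nat) : R :=
  real (Lim_seq (sum1 (fun n => / (INR n) ^ s))).

(* Main.v *)
Require Import Defs.
From Stdlib Require Import Reals List Lra Lia Ratan.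
From Coquelicot Require Import Coquelicot.
Import ListNotations.
Open Scope R_scope.

(** Write [m_k = 2k - 1]. Expanding [prod_(j <= N) 1 / (1 - x^2 / m_j^2)] in partial
    fractions gives coefficients [c_(N,k)] with [t*_N({2}^b) = sum_k c_(N,k) m_k^(-2b)].
    If [f(N) = sum_k c_(N,k) g(k)], then prefixing an entry 2 to the index replaces
    [g(k)] by [g(k) / m_k^2], and prefixing an entry 3 replaces it by
    [(g(k) / m_k^2 + 2 sum_(j < k) g(j) / m_j^2) / m_k]; both hold for every finite [N].
    As [c_(N,k)] tends to [- (4 / PI) (-1)^k / m_k], dominated convergence gives the
    first equality.

    For the second one, [m^(-q) + 2 sum_(n < m) n^(-q)] with [q] even equals
    [sum_(l >= 1) ((m - 2l)^(-q) - (m + 2l)^(-q))]. Exchanging the sums over [m] and [l],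
    expanding [m^(-p) (m -+ 2l)^(-q)] in partial fractions and using that [(-1)^k] changes
    sign under [m |-> m + 2] leaves, for each [l], a combination of the values
    [t(bar i)] with [i] odd and coefficients [(2l)^(-s)], [(-1)^l (2l)^(-s)]; summing
    over [l] produces the odd zeta values. *)

(** * Sums and limits *)

Lemma sum1_ext (f g : nat -> R) (N : nat) :
  (forall k, (1 <= k <= N)%nat -> f k = g k) -> sum1 f N = sum1 g N.
Proof.
  induction N as [|N IH]; intros H; simpl; [easy|].
  rewrite IH, (H (S N)); [easy|lia|intros k Hk; apply H; lia].
Qed.

Lemma sum1_plus (f g : nat -> R) (N : nat) :
  sum1 (fun k => f k + g k) N = sum1 f N + sum1 g N.
Proof. induction N as [|N IH]; simpl; [|rewrite IH]; ring. Qed.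

Lemma sum1_minus (f g : nat -> R) (N : nat) :
  sum1 (fun k => f k - g k) N = sum1 f N - sum1 g N.
Proof. induction N as [|N IH]; simpl; [|rewrite IH]; ring. Qed.

Lemma sum1_scal (c : R) (f : nat -> R) (N : nat) :
  sum1 (fun k => c * f k) N = c * sum1 f N.
Proof. induction N as [|N IH]; simpl; [|rewrite IH]; ring. Qed.

Lemma sum1_le (f g : nat -> R) (N : nat) :
  (forall k, (1 <= k <= N)%nat -> f k <= g k) -> sum1 f N <= sum1 g N.
Proof.
  induction N as [|N IH]; intros H; simpl; [lra|].
  apply Rplus_le_compat; [apply IH; intros k Hk|]; apply H; lia.
Qed.

Lemma Rabs_sum1_le (f g : nat -> R) (N : nat) :
  (forall k, (1 <= k <= N)%nat -> Rabs (f k) <= g k) ->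
  Rabs (sum1 f N) <= sum1 g N.
Proof.
  induction N as [|N IH]; intros H; simpl; [rewrite Rabs_R0; lra|].
  eapply Rle_trans; [apply Rabs_triang|].
  apply Rplus_le_compat; [apply IH; intros k Hk|]; apply H; lia.
Qed.

Lemma sum1_first (f : nat -> R) (N : nat) :
  sum1 f (S N) = f 1%nat + sum1 (fun k => f (S k)) N.
Proof.
  induction N as [|N IH]; [simpl; ring|].
  change (sum1 f (S (S N))) with (sum1 f (S N) + f (S (S N))).
  rewrite IH; simpl; ring.
Qed.

Lemma sum1_swap (f : nat -> nat -> R) (N M : nat) :
  sum1 (fun i => sum1 (f i) M) N = sum1 (fun j => sum1 (fun i => f i j) N) M.
Proof.
  induction N as [|N IH]; simpl.
  - induction M as [|M IH]; simpl; [|rewrite <- IH]; ring.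
  - rewrite IH, <- sum1_plus; easy.
Qed.

Lemma sum1_eventually_zero (f : nat -> R) (N M : nat) :
  (N <= M)%nat -> (forall k, (N < k)%nat -> f k = 0) -> sum1 f M = sum1 f N.
Proof.
  intros HNM Hf; induction HNM as [|M HM IH]; simpl; [easy|].
  rewrite IH, Hf by lia; ring.
Qed.

Lemma sum1_tail_le (f B : nat -> R) (K M : nat) :
  (forall k, (1 <= k)%nat -> Rabs (f k) <= B k) -> (K <= M)%nat ->
  Rabs (sum1 f M - sum1 f K) <= sum1 B M - sum1 B K.
Proof.
  intros Hf HKM; induction HKM as [|M HM IH]; simpl.
  - rewrite !Rminus_diag, Rabs_R0; lra.
  - replace (sum1 f M + f (S M) - sum1 f K)
      with ((sum1 f M - sum1 f K) + f (S M)) by ring.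
    eapply Rle_trans; [apply Rabs_triang|].
    specialize (Hf (S M) ltac:(lia)); lra.
Qed.

Lemma is_lim_seq_sum1 (f : nat -> nat -> R) (g : nat -> R) (N : nat) :
  (forall k, (1 <= k <= N)%nat -> is_lim_seq (fun n => f n k) (g k)) ->
  is_lim_seq (fun n => sum1 (f n) N) (sum1 g N).
Proof.
  induction N as [|N IH]; intros H; simpl; [apply is_lim_seq_const|].
  apply is_lim_seq_plus'; [apply IH; intros k Hk|]; apply H; lia.
Qed.

Lemma lim_dist_le (u : nat -> R) (l c e : R) (K : nat) :
  is_lim_seq u l -> (forall n, (K <= n)%nat -> Rabs (u n - c) <= e) ->
  Rabs (l - c) <= e.
Proof.
  intros Hu H.
  assert (L : is_lim_seq (fun n => Rabs (u n - c)) (Rabs (l - c))).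
  { apply (is_lim_seq_abs _ (Finite (l - c))).
    apply is_lim_seq_minus'; [easy|apply is_lim_seq_const]. }
  apply (is_lim_seq_le_loc (fun n => Rabs (u n - c)) (fun _ => e)
           (Finite (Rabs (l - c))) (Finite e)); [|easy|apply is_lim_seq_const].
  exists K; exact H.
Qed.

(** Weaker than domination by a summable sequence; it also covers rows that converge only
    conditionally, as in [wallis_lim]. *)
Definition uniform_tails (f : nat -> nat -> R) : Prop :=
  forall eps, 0 < eps -> exists K, forall n M, (K <= M)%nat ->
    Rabs (sum1 (f n) M - sum1 (f n) K) <= eps.

(** Cut at a [K] uniform in [n]: the tails of the rows are small, the tail of [g] inherits the bound
    in the limit, and the first [K] terms converge one by one. *)
Lemma lim_sum1_exchange (f : nat -> nat -> R) (g s : nat -> R) (G : R) :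
  uniform_tails f ->
  (forall k, (1 <= k)%nat -> is_lim_seq (fun n => f n k) (g k)) ->
  (forall n, is_lim_seq (sum1 (f n)) (s n)) ->
  is_lim_seq (sum1 g) G ->
  is_lim_seq s G.
Proof.
  intros Ht Hg Hs HG; apply is_lim_seq_spec; intros eps.
  assert (He : 0 < eps / 4) by (destruct eps; simpl; lra).
  destruct (Ht _ He) as [K HK].
  assert (Hf : forall M, is_lim_seq (fun n => sum1 (f n) M) (sum1 g M)).
  { intros M; apply is_lim_seq_sum1; intros k Hk; apply Hg; lia. }
  assert (H1 : forall n, Rabs (s n - sum1 (f n) K) <= eps / 4).
  { intros n; apply (lim_dist_le (sum1 (f n)) _ _ _ K); [easy|].
    intros M HM; apply HK, HM. }
  assert (H2 : Rabs (G - sum1 g K) <= eps / 4).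
  { apply (lim_dist_le (sum1 g) _ _ _ K); [easy|]; intros M HM.
    rewrite <- (Rminus_0_r (sum1 g M - sum1 g K)).
    apply (lim_dist_le (fun n => sum1 (f n) M - sum1 (f n) K) _ _ _ 0%nat).
    - apply is_lim_seq_minus'; apply Hf.
    - intros n _; rewrite Rminus_0_r; apply HK, HM. }
  pose proof (Hf K) as H3; apply is_lim_seq_spec in H3.
  destruct (H3 (mkposreal _ He)) as [n0 Hn0]; simpl in Hn0.
  exists n0; intros n Hn; specialize (Hn0 n Hn); specialize (H1 n).
  replace (s n - G) with
    ((s n - sum1 (f n) K) + (sum1 (f n) K - sum1 g K) - (G - sum1 g K)) by ring.
  assert (Hp : 0 < eps) by (destruct eps; simpl; lra).
  revert H1 H2 Hn0; unfold Rabs; repeat destruct Rcase_abs; lra.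
Qed.

Lemma dominated_uniform_tails (f : nat -> nat -> R) (B : nat -> R) :
  ex_finite_lim_seq (sum1 B) ->
  (forall n k, (1 <= k)%nat -> Rabs (f n k) <= B k) -> uniform_tails f.
Proof.
  intros [l Hl] Hf eps Heps.
  apply is_lim_seq_spec in Hl.
  destruct (Hl (mkposreal (eps / 2) ltac:(lra))) as [K HK]; simpl in HK.
  exists K; intros n M HM.
  eapply Rle_trans; [apply sum1_tail_le; [apply Hf|exact HM]|].
  pose proof (HK K (le_n K)) as H1; pose proof (HK M HM) as H2.
  apply Rabs_def2 in H1; apply Rabs_def2 in H2; lra.
Qed.

(** * Alternating series and inverse powers *)

Lemma pow_m1_sqr (n : nat) : (-1) ^ n * (-1) ^ n = 1.
Proof.
  rewrite <- Rpow_mult_distr; replace (-1 * -1) with 1 by ring; apply pow1.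
Qed.

(** Multiplied by the sign of its first term, a block after [K] lies between 0 and [a (S K)].
    Peeling off that term leaves a block of opposite sign, hence the induction on the length for all
    starting points. *)
Lemma alternating_tail (a : nat -> R) (K M : nat) :
  (forall k, (1 <= k)%nat -> 0 <= a (S k) <= a k) -> (K <= M)%nat ->
  Rabs (sum1 (fun k => (-1) ^ k * a k) M - sum1 (fun k => (-1) ^ k * a k) K)
    <= a (S K).
Proof.
  intros Ha HKM.
  set (f := fun k => (-1) ^ k * a k).
  assert (H : forall d K, 0 <= (-1) ^ S K * (sum1 f (K + d) - sum1 f K) <= a (S K)).
  { intros d; induction d as [|d IH]; intros J.
    - rewrite Nat.add_0_r, Rminus_diag, Rmult_0_r.
      specialize (Ha (S J) ltac:(lia)); lra.
    - specialize (IH (S J)); specialize (Ha (S J) ltac:(lia)).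
      replace (S J + d)%nat with (J + S d)%nat in IH by lia.
      replace (sum1 f (J + S d) - sum1 f J)
        with (f (S J) + (sum1 f (J + S d) - sum1 f (S J))) by (simpl; ring).
      assert (E : (-1) ^ S J * f (S J) = a (S J)).
      { unfold f; rewrite <- Rmult_assoc, pow_m1_sqr; ring. }
      rewrite Rmult_plus_distr_l, E.
      change ((-1) ^ S (S J)) with (-1 * (-1) ^ S J) in IH.
      rewrite Rmult_assoc in IH; lra. }
  specialize (H (M - K)%nat K); replace (K + (M - K))%nat with M in H by lia.
  replace (Rabs (sum1 f M - sum1 f K))
    with (Rabs ((-1) ^ S K * (sum1 f M - sum1 f K))).
  - rewrite Rabs_pos_eq; lra.
  - rewrite Rabs_mult, pow_1_abs; ring.
Qed.

Lemma ex_lim_alternating (a : nat -> R) :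
  (forall k, (1 <= k)%nat -> 0 <= a (S k) <= a k) -> is_lim_seq a 0 ->
  ex_finite_lim_seq (sum1 (fun k => (-1) ^ k * a k)).
Proof.
  intros Ha H0; apply ex_lim_seq_cauchy_corr; intros eps.
  apply is_lim_seq_spec in H0.
  assert (He : 0 < eps / 2) by (destruct eps; simpl; lra).
  destruct (H0 (mkposreal _ He)) as [N HN]; simpl in HN.
  exists N; intros n m Hn Hm.
  pose proof (alternating_tail a N n Ha Hn) as H1.
  pose proof (alternating_tail a N m Ha Hm) as H2.
  specialize (HN (S N) ltac:(lia)); rewrite Rminus_0_r in HN.
  pose proof (Rle_abs (a (S N))).
  apply Rabs_le_between in H1; apply Rabs_le_between in H2.
  apply Rabs_def1; lra.
Qed.

(* The bound [2 - 1/N] telescopes because [1/k^2 <= 1/(k-1) - 1/k]. *)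
Lemma sum1_inv_sqr_le (N : nat) :
  (1 <= N)%nat -> sum1 (fun k => / INR k ^ 2) N <= 2 - / INR N.
Proof.
  intros HN; induction HN as [|N HN IH]; [simpl; lra|].
  cbn [sum1]; rewrite S_INR.
  assert (1 <= INR N) by (apply (le_INR 1), HN).
  enough (/ (INR N + 1) ^ 2 <= / INR N - / (INR N + 1)) by lra.
  replace (/ INR N - / (INR N + 1)) with (/ (INR N * (INR N + 1))) by (field; lra).
  apply Rinv_le_contravar; nra.
Qed.

Lemma sum1_inv_sqr_le_2 (N : nat) : sum1 (fun k => / INR k ^ 2) N <= 2.
Proof.
  destruct N as [|N]; [simpl; lra|].
  eapply Rle_trans; [apply sum1_inv_sqr_le; lia|].
  assert (0 < / INR (S N)) by (apply Rinv_0_lt_compat, lt_0_INR; lia); lra.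
Qed.

Lemma ex_lim_sum1_bounded (f : nat -> R) (C : R) :
  (forall k, (1 <= k)%nat -> 0 <= f k) -> (forall N, sum1 f N <= C) ->
  ex_finite_lim_seq (sum1 f).
Proof.
  intros Hf HC; apply ex_finite_lim_seq_incr with C; [|exact HC].
  intros n; simpl; specialize (Hf (S n) ltac:(lia)); lra.
Qed.

Lemma ex_lim_inv_pow (s : nat) : (2 <= s)%nat ->
  ex_finite_lim_seq (sum1 (fun n => / INR n ^ s)).
Proof.
  intros Hs; apply ex_lim_sum1_bounded with 2.
  - intros k Hk; left; apply Rinv_0_lt_compat, pow_lt, lt_0_INR; lia.
  - intros N; eapply Rle_trans; [|apply (sum1_inv_sqr_le_2 N)].
    apply sum1_le; intros k Hk.
    assert (1 <= INR k) by (apply (le_INR 1); lia).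
    apply Rinv_le_contravar; [apply pow_lt; lra|apply Rle_pow; [lra|lia]].
Qed.

Lemma zeta_lim (s : nat) : (2 <= s)%nat ->
  is_lim_seq (sum1 (fun n => / INR n ^ s)) (zeta s).
Proof.
  intros Hs; destruct (ex_lim_inv_pow s Hs) as [l Hl].
  unfold zeta; rewrite (is_lim_seq_unique _ _ Hl); easy.
Qed.

(** * Reciprocal powers of the odd numbers *)

Definition od (k : nat) : R := 2 * INR k - 1.

Lemma od_S (k : nat) : od (S k) = od k + 2.
Proof. unfold od; rewrite S_INR; ring. Qed.

Lemma od_ge (k : nat) : (1 <= k)%nat -> INR k <= od k.
Proof. intros Hk; unfold od; apply (le_INR 1) in Hk; simpl in Hk; lra. Qed.

Lemma od_ge_1 (k : nat) : (1 <= k)%nat -> 1 <= od k.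
Proof. intros Hk; unfold od; apply (le_INR 1) in Hk; simpl in Hk; lra. Qed.

Lemma oddinv_od (k s : nat) : (1 <= k)%nat -> oddinv k s = / od k ^ s.
Proof.
  intros Hk; unfold oddinv, od; do 2 f_equal.
  rewrite minus_INR, mult_INR by lia; simpl; ring.
Qed.

Lemma inv_pow_od_le (k s : nat) : (1 <= k)%nat -> (2 <= s)%nat ->
  0 <= / od k ^ s <= / INR k ^ 2.
Proof.
  intros Hk Hs; pose proof (od_ge_1 k Hk); pose proof (od_ge k Hk).
  assert (0 < INR k) by (apply lt_0_INR; lia).
  assert (0 < od k ^ s) by (apply pow_lt; lra).
  split; [left; apply Rinv_0_lt_compat; lra|].
  apply Rinv_le_contravar; [apply pow_lt; lra|].
  apply Rle_trans with (od k ^ 2); [apply pow_incr; lra|].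
  apply Rle_pow; [lra|lia].
Qed.

Lemma sum1_inv_pow_od_le (N s : nat) : (2 <= s)%nat ->
  sum1 (fun k => / od k ^ s) N <= 2.
Proof.
  intros Hs; eapply Rle_trans; [|apply (sum1_inv_sqr_le_2 N)].
  apply sum1_le; intros k Hk; apply inv_pow_od_le; lia.
Qed.

(** * Partial fractions and t-star sums *)

(** The partial Wallis product of (2i+3)^2 / ((2i+2)(2i+4)) over [i < n], increasing to [4 / PI]; it
    equals both [pfc n 0] and [pfc n 1]. *)
Fixpoint wallis (n : nat) : R :=
  match n with
  | O => 1
  | S n' => wallis n' * ((2 * INR n' + 3) ^ 2 / (4 * (INR n' + 1) * (INR n' + 2)))
  end.

(* With [N = n + 1], the coefficient of [1 / (1 - x^2 / od k ^ 2)] in the partial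
   fraction expansion of [prod_(j <= N) 1 / (1 - x^2 / od j ^ 2)] is
   [- (-1) ^ k * pfc n k / od k]. *)
Fixpoint pfc (n k : nat) : R :=
  match k with
  | O => wallis n
  | S k' => pfc n k' * ((INR n + 1 - INR k') / (INR n + 1 + INR k'))
  end.

Lemma wallis_pos (n : nat) : 0 < wallis n.
Proof.
  induction n as [|n IH]; cbn [wallis]; [lra|]; pose proof (pos_INR n).
  apply Rmult_lt_0_compat; [easy|]; apply Rdiv_lt_0_compat; nra.
Qed.

(** The correction factor makes the product decrease from its value 2 at [n = 0]; the bare bound
    [wallis n <= 2] is not inductive. *)
Lemma wallis_le (n : nat) : wallis n * ((2 * INR n + 2) / (2 * INR n + 1)) <= 2.
Proof.
  induction n as [|n IH]; cbn [wallis]; [simpl; lra|].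
  eapply Rle_trans; [|exact IH]; rewrite S_INR.
  pose proof (wallis_pos n); pose proof (pos_INR n).
  rewrite Rmult_assoc; apply Rmult_le_compat_l; [lra|].
  apply Rminus_le_0.
  replace (_ - _) with (/ (2 * (INR n + 1) * (2 * INR n + 1))) by (field; lra).
  left; apply Rinv_0_lt_compat; nra.
Qed.

Lemma wallis_le_2 (n : nat) : wallis n <= 2.
Proof.
  eapply Rle_trans; [|apply (wallis_le n)].
  pose proof (wallis_pos n); pose proof (pos_INR n).
  rewrite <- (Rmult_1_r (wallis n)) at 1; apply Rmult_le_compat_l; [lra|].
  apply Rle_div_r; lra.
Qed.

Lemma wallis_incr (n : nat) : wallis n <= wallis (S n).
Proof.
  pose proof (wallis_pos n); pose proof (pos_INR n); cbn [wallis].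
  rewrite <- (Rmult_1_r (wallis n)) at 1; apply Rmult_le_compat_l; [lra|].
  apply Rle_div_r; nra.
Qed.

(** The numerator of the factor at [k' = n + 1] is 0. This lets sums over [k <= n + 1] be read as
    infinite series, as the exchange of limits requires. *)
Lemma pfc_zero (n k : nat) : (n + 1 < k)%nat -> pfc n k = 0.
Proof.
  induction k as [|k IH]; [lia|]; intros Hk; cbn [pfc].
  destruct (Nat.eq_dec k (n + 1)) as [->|Hne].
  - rewrite plus_INR; simpl (INR 1); replace (_ - _) with 0 by ring.
    unfold Rdiv; ring.
  - rewrite IH by lia; ring.
Qed.

Lemma pfc_nonneg (n k : nat) : 0 <= pfc n k.
Proof.
  destruct (Nat.le_gt_cases k (n + 1)) as [Hk|Hk]; [|rewrite pfc_zero; [lra|lia]].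
  induction k as [|k IH]; cbn [pfc]; [left; apply wallis_pos|].
  apply Rmult_le_pos; [apply IH; lia|].
  pose proof (pos_INR n); pose proof (pos_INR k).
  assert (INR k <= INR n + 1) by (rewrite <- S_INR; apply le_INR; lia).
  apply Rmult_le_pos; [lra|]; left; apply Rinv_0_lt_compat; lra.
Qed.

Lemma pfc_decr (n k : nat) : pfc n (S k) <= pfc n k.
Proof.
  cbn [pfc]; rewrite <- (Rmult_1_r (pfc n k)) at 2.
  apply Rmult_le_compat_l; [apply pfc_nonneg|].
  pose proof (pos_INR n); pose proof (pos_INR k).
  apply Rle_div_l; lra.
Qed.

Lemma pfc_le_2 (n k : nat) : pfc n k <= 2.
Proof.
  induction k as [|k IH]; [apply wallis_le_2|].
  pose proof (pfc_decr n k); lra.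
Qed.

(** A new factor 1 / (1 - x^2 / od (n+2)^2) divides the coefficient at [x = od k] by 1 - od k^2 / od
    (n+2)^2. In product form this stays true at [k = n + 2], where both sides are 0. *)
Lemma pfc_step (n k : nat) :
  pfc n k = pfc (S n) k * (1 - od k ^ 2 / od (S (S n)) ^ 2).
Proof.
  unfold od; pose proof (pos_INR n).
  induction k as [|k IH]; cbn [pfc wallis].
  - rewrite !S_INR; simpl (INR 0); field; lra.
  - rewrite IH, !S_INR; pose proof (pos_INR k); field; lra.
Qed.

Lemma pfc_rec (n k : nat) :
  pfc n (S k) * (od (S n) + od (S k)) = pfc n k * (od (S n) - od k).
Proof.
  cbn [pfc]; unfold od; rewrite !S_INR.
  pose proof (pos_INR n); pose proof (pos_INR k); field; lra.
Qed.

Definition pf_sum (n : nat) (g : nat -> R) : R :=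
  sum1 (fun k => - (-1) ^ k * pfc n k / od k * g k) (S n).

Lemma pf_sum_ext (n : nat) (g h : nat -> R) :
  (forall k, (1 <= k)%nat -> g k = h k) -> pf_sum n g = pf_sum n h.
Proof. intros H; apply sum1_ext; intros k Hk; rewrite H; [easy|lia]. Qed.

(** Turns [pfc_step] into the increment from one truncation to the next; the identities below
    compare such increments. *)
Lemma pf_sum_step (n : nat) (g : nat -> R) :
  pf_sum (S n) g
  = pf_sum n g + pf_sum (S n) (fun k => od k ^ 2 * g k) / od (S (S n)) ^ 2.
Proof.
  assert (E : pf_sum n g = sum1 (fun k => - (-1) ^ k * pfc n k / od k * g k) (S (S n))).
  { unfold pf_sum; cbn [sum1]; rewrite (pfc_zero n (S (S n))) by lia.
    unfold Rdiv; ring. }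
  rewrite E; unfold pf_sum, Rdiv.
  rewrite (Rmult_comm _ (/ _ ^ 2)), <- sum1_scal, <- sum1_plus.
  apply sum1_ext; intros k Hk; rewrite (pfc_step n k).
  unfold Rdiv; ring.
Qed.

(** The partial fraction expansion at [x = 0]. *)
Lemma pf_sum_one (n : nat) : pf_sum n (fun _ => 1) = 1.
Proof.
  induction n as [|n IH].
  { unfold pf_sum, od; simpl; field. }
  rewrite pf_sum_step, IH.
  enough (E : pf_sum (S n) (fun k => od k ^ 2 * 1) = 0) by (rewrite E; unfold Rdiv; ring).
  pose proof (pos_INR n).
  (* The partial sums have a closed form whose factor [INR n + 2 - INR j] vanishes at the upper end
     [j = n + 2]. *)
  assert (H1 : forall j, (j <= S (S n))%nat ->
    sum1 (fun k => - (-1) ^ k * pfc (S n) k / od k * (od k ^ 2 * 1)) j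
    = - (-1) ^ j * pfc (S n) j * INR j * (INR n + 2 - INR j) / (INR n + 1)).
  { induction j as [|j IHj]; intros Hj; [simpl; field; lra|].
    cbn [sum1]; rewrite IHj by lia; pose proof (od_ge_1 (S j) ltac:(lia)).
    pose proof (pfc_rec (S n) j) as Hr; revert Hr H0; unfold od; rewrite !S_INR.
    simpl ((-1) ^ S j); intros Hr H0; pose proof (pos_INR j).
    apply (Rmult_eq_reg_r (INR n + 1)); [|lra].
    replace (pfc (S n) (S j)) with (pfc (S n) j * ((INR n + 2 - INR j) / (INR n + 2 + INR j)))
      by (cbn [pfc]; rewrite S_INR; f_equal; field; lra).
    field; lra. }
  unfold pf_sum; rewrite H1 by lia; rewrite !S_INR; unfold Rdiv; ring.
Qed.

(** Both sides agree at truncation 1 and gain [f N / od N ^ 2] at truncation [N]: the [od k ^ 2]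
    from [pf_sum_step] cancels the inverse square. *)
Lemma pf_sum_T2 (f g : nat -> R) (n : nat) :
  (forall n, f (S n) = pf_sum n g) ->
  sum1 (fun k => oddinv k 2 * f k) (S n) = pf_sum n (fun k => / od k ^ 2 * g k).
Proof.
  intros Hf; induction n as [|n IH].
  - cbn [sum1]; rewrite Hf, oddinv_od by lia; unfold pf_sum, od; simpl; field.
  - change (sum1 (fun k => oddinv k 2 * f k) (S (S n)))
      with (sum1 (fun k => oddinv k 2 * f k) (S n) + oddinv (S (S n)) 2 * f (S (S n))).
    rewrite IH, Hf, (pf_sum_step n (fun k => / od k ^ 2 * g k)), oddinv_od by lia.
    f_equal.
    rewrite Rmult_comm; unfold Rdiv; f_equal.
    apply pf_sum_ext; intros k Hk; pose proof (od_ge_1 k Hk); field; lra.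
Qed.

Definition central_sum (x : nat -> R) (k : nat) : R := x k + 2 * sum1 x (k - 1).

(* Summation by parts: [pfc_rec] is exactly what makes the boundary term telescope. *)
Lemma pf_sum_parts (n : nat) (x : nat -> R) (K : nat) :
  od (S n) * sum1 (fun k => (-1) ^ k * pfc n k * central_sum x k) K
  - sum1 (fun k => (-1) ^ k * pfc n k * (od k * x k)) K
  = (-1) ^ K * pfc n K * (od (S n) - od K) * sum1 x K.
Proof.
  induction K as [|K IH]; [simpl; ring|].
  cbn [sum1]; unfold central_sum at 2; replace (S K - 1)%nat with K by lia.
  match goal with |- ?o * (?A + ?B) - (?C + ?D) = _ =>
    replace (o * (A + B) - (C + D)) with ((o * A - C) + (o * B - D)) by ring end.
  rewrite IH; simpl ((-1) ^ S K).
  match goal with |- ?s * _ * _ * ?G + _ = _ =>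
    pose proof (f_equal (fun z => s * z * G) (pfc_rec n K)) as Hr end.
  cbv beta in Hr; lra.
Qed.

(** Increments are compared again; [pf_sum_parts] exchanges the weight [central_sum] for the third
    factor [/ od N]. *)
Lemma pf_sum_T3 (f g : nat -> R) (n : nat) :
  (forall n, f (S n) = pf_sum n g) ->
  sum1 (fun k => oddinv k 3 * f k) (S n)
  = pf_sum n (fun k => / od k * central_sum (fun j => / od j ^ 2 * g j) k).
Proof.
  intros Hf; induction n as [|n IH].
  - cbn [sum1]; rewrite Hf, oddinv_od by lia; unfold pf_sum, central_sum, od; simpl; field.
  - change (sum1 (fun k => oddinv k 3 * f k) (S (S n)))
      with (sum1 (fun k => oddinv k 3 * f k) (S n) + oddinv (S (S n)) 3 * f (S (S n))).
    rewrite IH, Hf, (pf_sum_step n (fun k => / od k * _)), oddinv_od by lia.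
    f_equal.
    set (x := fun j => / od j ^ 2 * g j).
    (* At [K = S (S n)] the boundary factor [od (S (S n)) - od K] is 0. *)
    pose proof (pf_sum_parts (S n) x (S (S n))) as Hp.
    rewrite Rminus_diag, Rmult_0_r, Rmult_0_l in Hp.
    assert (E1 : pf_sum (S n) (fun k => od k ^ 2 * (/ od k * central_sum x k))
      = - sum1 (fun k => (-1) ^ k * pfc (S n) k * central_sum x k) (S (S n))).
    { unfold pf_sum; rewrite <- (Rmult_1_l (sum1 _ _)) at 1.
      rewrite <- (Ropp_involutive 1), Ropp_mult_distr_l_reverse; f_equal.
      rewrite <- sum1_scal; apply sum1_ext; intros k Hk.
      pose proof (od_ge_1 k ltac:(lia)); field; lra. }
    assert (E2 : pf_sum (S n) g
      = - sum1 (fun k => (-1) ^ k * pfc (S n) k * (od k * x k)) (S (S n))).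
    { unfold pf_sum; rewrite <- (Rmult_1_l (sum1 _ _)) at 1.
      rewrite <- (Ropp_involutive 1), Ropp_mult_distr_l_reverse; f_equal.
      rewrite <- sum1_scal; apply sum1_ext; intros k Hk; unfold x.
      pose proof (od_ge_1 k ltac:(lia)); field; lra. }
    rewrite E1, E2; pose proof (od_ge_1 (S (S n)) ltac:(lia)).
    apply Rminus_diag_uniq in Hp; rewrite <- Hp; field; lra.
Qed.

Lemma tstar_trunc_twos (b n : nat) :
  tstar_trunc (repeat 2%nat b) (S n) = pf_sum n (fun k => / od k ^ (2 * b)).
Proof.
  revert n; induction b as [|b IH]; intros n.
  - cbn [repeat tstar_trunc]; rewrite <- (pf_sum_one n).
    apply pf_sum_ext; intros k _; simpl; field.
  - cbn [repeat tstar_trunc]; rewrite (pf_sum_T2 _ _ n IH).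
    apply pf_sum_ext; intros k Hk; pose proof (od_ge_1 k Hk).
    replace (2 * S b)%nat with (2 + 2 * b)%nat by lia.
    rewrite pow_add, Rinv_mult; easy.
Qed.

(** The term [j = k] taken once and the terms [j < k] taken twice give the weights of the single and
    the double t-value. *)
Definition hsum (b : nat) : nat -> R := central_sum (fun j => / od j ^ (2 * b + 2)).

(** The 3 leaves one [/ od k] outside [hsum] and each preceding 2 adds two more; the exponent
    becomes [2 * a + 2] once the [/ od k] inside [pf_sum] is included. *)
Lemma tstar_trunc_pf_sum (a b n : nat) :
  tstar_trunc (repeat 2%nat a ++ 3%nat :: repeat 2%nat b) (S n)
  = pf_sum n (fun k => / od k ^ (2 * a + 1) * hsum b k).
Proof.
  revert n; induction a as [|a IH]; intros n.
  - cbn [repeat tstar_trunc app].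
    rewrite (pf_sum_T3 _ _ n (tstar_trunc_twos b)).
    apply pf_sum_ext; intros k Hk; rewrite pow_1; f_equal.
    unfold hsum, central_sum; f_equal; [|f_equal; apply sum1_ext; intros j Hj];
      rewrite Nat.add_comm, pow_add, Rinv_mult; easy.
  - cbn [repeat tstar_trunc app]; rewrite (pf_sum_T2 _ _ n IH).
    apply pf_sum_ext; intros k Hk; pose proof (od_ge_1 k Hk).
    replace (2 * S a + 1)%nat with (2 + (2 * a + 1))%nat by lia.
    rewrite (pow_add _ 2), Rinv_mult; ring.
Qed.

(** * Limits of the coefficients and of the t-star sums *)

Lemma pfc_lim (L : R) (k : nat) :
  is_lim_seq wallis L -> is_lim_seq (fun n => pfc n k) L.
Proof.
  intros HL; induction k as [|k IH]; [easy|]; cbn [pfc].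
  replace (Finite L) with (Finite (L * (1 - 0))) by (f_equal; ring).
  apply is_lim_seq_mult'; [easy|].
  apply is_lim_seq_ext with (fun n => 1 - 2 * INR k * / (INR n + (1 + INR k))).
  { intros n; pose proof (pos_INR n); pose proof (pos_INR k); field; lra. }
  apply is_lim_seq_minus'; [apply is_lim_seq_const|].
  replace (Finite 0) with (Rbar_mult (2 * INR k) 0) by (simpl; f_equal; ring).
  apply is_lim_seq_scal_l.
  apply (is_lim_seq_inv _ p_infty); [|easy].
  apply is_lim_seq_plus with (l1 := p_infty) (l2 := Finite (1 + INR k));
    [apply is_lim_seq_INR|apply is_lim_seq_const|easy].
Qed.

Lemma inv_od_lim : is_lim_seq (fun k => / od k) 0.
Proof.
  apply (is_lim_seq_inv _ p_infty); [|easy].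
  apply is_lim_seq_le_p_loc with INR; [|apply is_lim_seq_INR].
  exists 1%nat; apply od_ge.
Qed.

(** The sign is negative because numbering from [k = 1] makes the series start with -1. *)
Lemma leibniz : is_lim_seq (sum1 (fun k => (-1) ^ k / od k)) (- (PI / 4)).
Proof.
  rewrite <- Alt_PI_eq; unfold Alt_PI; destruct exist_PI as [l Hl].
  replace (- (4 * l / 4)) with (- 1 * l) by field.
  apply is_lim_seq_incr_1.
  apply is_lim_seq_ext with (fun n => - 1 * sum_f_R0 (tg_alt PI_tg) n).
  - intros n; induction n as [|n IH].
    + unfold tg_alt, PI_tg, od; simpl; field.
    + cbn [sum_f_R0]; rewrite Rmult_plus_distr_l, IH; cbn [sum1]; f_equal.
      unfold tg_alt, PI_tg, od; rewrite plus_INR, mult_INR, !S_INR; simpl.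
      pose proof (pos_INR n); field; lra.
  - apply (is_lim_seq_scal_l _ (-1) (Finite l)); apply is_lim_seq_Reals, Hl.
Qed.

(* Comparing [pf_sum_one] in the limit with Leibniz's series forces the value. *)
Lemma wallis_lim : is_lim_seq wallis (4 / PI).
Proof.
  destruct (ex_finite_lim_seq_incr wallis 2 wallis_incr wallis_le_2) as [L HL].
  enough (E : 1 = - L * (- (PI / 4))).
  { pose proof PI_RGT_0; replace (4 / PI) with L; [easy|].
    apply (Rmult_eq_reg_r (PI / 4)); [|lra].
    replace (4 / PI * (PI / 4)) with 1 by (field; lra); lra. }
  set (f := fun n k => (-1) ^ k * (pfc n k / od k)).
  (* Every row sums to -1 by [pf_sum_one]. *)
  assert (H : is_lim_seq (fun _ : nat => - (1)) (L * (- (PI / 4)))).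
  { apply (lim_sum1_exchange f (fun k => L * ((-1) ^ k / od k))).
    (* The limit series converges only conditionally, so domination fails. The alternating bound
       gives tails of at most [2 / od (S K)], hence [eps / 2]. *)
    - intros eps He.
      pose proof inv_od_lim as H0; apply is_lim_seq_spec in H0.
      destruct (H0 (mkposreal (eps / 2) ltac:(lra))) as [K HK]; simpl in HK.
      exists K; intros n M HM.
      eapply Rle_trans; [apply (alternating_tail (fun k => pfc n k / od k))|]; [|easy|].
      + intros k Hk; pose proof (od_ge_1 k Hk); pose proof (od_S k).
        pose proof (pfc_decr n k); pose proof (pfc_nonneg n (S k)); split.
        * apply Rmult_le_pos; [easy|]; left; apply Rinv_0_lt_compat; lra.
        * apply Rmult_le_compat; [easy| |easy|].
          -- left; apply Rinv_0_lt_compat; lra.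
          -- apply Rinv_le_contravar; lra.
      + specialize (HK (S K) ltac:(lia)); rewrite Rminus_0_r in HK.
        pose proof (Rle_abs (/ od (S K))); pose proof (pfc_le_2 n (S K)).
        pose proof (od_ge_1 (S K) ltac:(lia)).
        assert (0 < / od (S K)) by (apply Rinv_0_lt_compat; lra).
        unfold Rdiv; nra.
    - intros k Hk; unfold f.
      apply is_lim_seq_ext with (fun n => (-1) ^ k / od k * pfc n k).
      { intros n; unfold Rdiv; ring. }
      rewrite (Rmult_comm L).
      apply (is_lim_seq_scal_l _ _ (Finite L)); apply pfc_lim, HL.
    - intros n; apply is_lim_seq_ext_loc with (fun _ => - (1)); [|apply is_lim_seq_const].
      exists (S n); intros M HM; unfold f.
      rewrite (sum1_eventually_zero _ (S n) M HM).
      + rewrite <- (pf_sum_one n); unfold pf_sum.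
        rewrite <- (Rmult_1_l (sum1 _ _)) at 1.
        rewrite <- Ropp_mult_distr_l_reverse, <- sum1_scal.
        apply sum1_ext; intros k _; unfold Rdiv; ring.
      + intros k Hk; rewrite pfc_zero by lia; unfold Rdiv; ring.
    - apply is_lim_seq_ext with (fun n => L * sum1 (fun k => (-1) ^ k / od k) n).
      { intros n; rewrite sum1_scal; easy. }
      apply (is_lim_seq_scal_l _ L (Finite (- (PI / 4)))), leibniz. }
  apply is_lim_seq_unique in H; rewrite Lim_seq_const in H.
  injection H; lra.
Qed.

(** The 5 is 1 for the term at [k] plus twice the bound 2 on the sum of inverse powers. *)
Lemma hsum_bound (b k : nat) : (1 <= k)%nat -> 0 <= hsum b k <= 5.
Proof.
  intros Hk; unfold hsum, central_sum.
  pose proof (inv_pow_od_le k (2 * b + 2) Hk ltac:(lia)) as [H1 H2].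
  pose proof (sum1_inv_pow_od_le (k - 1) (2 * b + 2) ltac:(lia)).
  assert (0 <= sum1 (fun j => / od j ^ (2 * b + 2)) (k - 1)).
  { replace 0 with (sum1 (fun _ => 0) (k - 1)).
    - apply sum1_le; intros j Hj; apply inv_pow_od_le; lia.
    - generalize (k - 1)%nat; induction n as [|n IH]; simpl; lra. }
  assert (/ INR k ^ 2 <= 1); [|lra].
  rewrite <- Rinv_1; apply Rinv_le_contravar; [lra|].
  apply pow_R1_Rle, (le_INR 1), Hk.
Qed.

(** Dominated convergence in [tstar_trunc_pf_sum]. Convergence to [D] is assumed here;
    [double_sum_lim] supplies it with its value. *)
Lemma tstar_lim (a b : nat) (D : R) :
  is_lim_seq (sum1 (fun k => (-1) ^ k * / od k ^ (2 * a + 2) * hsum b k)) D ->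
  tstar (repeat 2%nat a ++ 3%nat :: repeat 2%nat b) = - (4 / PI) * D.
Proof.
  intros HD; unfold tstar.
  rewrite (is_lim_seq_unique _ (Finite (- (4 / PI) * D))); [easy|].
  apply is_lim_seq_incr_1.
  apply is_lim_seq_ext with (fun n => pf_sum n (fun k => / od k ^ (2 * a + 1) * hsum b k)).
  { intros n; symmetry; apply tstar_trunc_pf_sum. }
  set (e := fun k => (-1) ^ k * / od k ^ (2 * a + 2) * hsum b k) in *.
  apply (lim_sum1_exchange (fun n k => - e k * pfc n k) (fun k => - (4 / PI) * e k)).
  (* The 10 is the bound 5 on [hsum] times the bound 2 on [pfc]. *)
  - apply dominated_uniform_tails with (fun k => 10 * / INR k ^ 2).
    + exists (10 * zeta 2).
      apply is_lim_seq_ext with (fun n => 10 * sum1 (fun k => / INR k ^ 2) n).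
      { intros n; rewrite sum1_scal; easy. }
      apply (is_lim_seq_scal_l _ 10 (Finite _)), zeta_lim; lia.
    + intros n k Hk; unfold e.
      rewrite Rabs_mult, Rabs_Ropp, !Rabs_mult, pow_1_abs, Rmult_1_l.
      pose proof (hsum_bound b k Hk); pose proof (pfc_le_2 n k).
      pose proof (pfc_nonneg n k).
      pose proof (inv_pow_od_le k (2 * a + 2) Hk ltac:(lia)).
      rewrite !Rabs_pos_eq by lra.
      apply Rle_trans with (/ INR k ^ 2 * 5 * 2); [|lra].
      apply Rmult_le_compat; try lra; [apply Rmult_le_pos; lra|].
      apply Rmult_le_compat; lra.
  - intros k Hk.
    replace (- (4 / PI) * e k) with (- e k * (4 / PI)) by ring.
    apply (is_lim_seq_scal_l _ _ (Finite (4 / PI))); apply pfc_lim, wallis_lim.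
  - intros n.
    apply is_lim_seq_ext_loc with
      (fun _ => pf_sum n (fun k => / od k ^ (2 * a + 1) * hsum b k));
      [|apply is_lim_seq_const].
    exists (S n); intros M HM.
    rewrite (sum1_eventually_zero _ (S n) M HM).
    + unfold pf_sum; apply sum1_ext; intros k Hk; unfold e.
      pose proof (od_ge_1 k ltac:(lia)).
      replace (2 * a + 2)%nat with (S (2 * a + 1)) by lia; rewrite <- tech_pow_Rmult.
      rewrite Rinv_mult; unfold Rdiv; ring.
    + intros k Hk; rewrite pfc_zero by lia; ring.
  - apply is_lim_seq_ext with (fun n => - (4 / PI) * sum1 e n).
    { intros n; rewrite sum1_scal; easy. }
    apply (is_lim_seq_scal_l _ (- (4 / PI)) (Finite D)), HD.
Qed.

(** * The alternating double sum *)

Lemma binom_small (n k : nat) : (n < k)%nat -> binom n k = 0%nat.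
Proof.
  revert k; induction n as [|n IH]; intros [|k] Hk; try lia; [easy|].
  cbn [binom]; rewrite !IH by lia; easy.
Qed.

(** [X p q] stands for a sum of x^(-p) y^(-q) with x - y = h. Each use of the recurrence lowers one
    exponent; paths from (P+1, Q+1) stop when an exponent reaches 0 after [t] steps, and the
    binomials count them, the last step being forced. Keeping [X] abstract lets the expansion apply
    to whole sums. *)
Lemma partial_fraction (h : R) (X : nat -> nat -> R) (P Q : nat) :
  h <> 0 ->
  (forall p q, h * X (S p) (S q) = X p (S q) - X (S p) q) ->
  X (S P) (S Q) =
  sum1 (fun t => / h ^ t *
    ((-1) ^ S Q * INR (binom (t - 1) Q) * X (P + Q + 2 - t)%nat 0%nat
     - (-1) ^ (P + t) * INR (binom (t - 1) P) * X 0%nat (P + Q + 2 - t)%nat))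
    (P + Q + 1).
Proof.
  intros Hh HX.
  assert (HX' : forall p q, X (S p) (S q) = / h * (X p (S q) - X (S p) q)).
  { intros p q; rewrite <- HX; field; easy. }
  assert (B0 : forall n, binom n 0 = 1%nat) by (intros [|n]; easy).
  revert Q; induction P as [|P IHP]; induction Q as [|Q IHQ].
  - simpl; rewrite HX'; field; easy.
  - replace (0 + S Q + 1)%nat with (S (0 + Q + 1)) by lia.
    rewrite HX', IHQ, sum1_first.
    replace (0 + S Q + 2 - 1)%nat with (S (S Q)) by lia.
    rewrite Rmult_minus_distr_l, <- sum1_scal.
    unfold Rminus at 1; f_equal; [simpl; field; easy|].
    rewrite <- (Rmult_1_l (sum1 _ _)), <- Ropp_mult_distr_l_reverse, <- sum1_scal.
    apply sum1_ext; intros [|k] Hk; [lia|].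
    replace (0 + S Q + 2 - S (S k))%nat with (0 + Q + 2 - S k)%nat by lia.
    replace (S (S k) - 1)%nat with (S k) by lia.
    replace (S k - 1)%nat with k by lia.
    cbn [binom]; rewrite B0, (binom_small k (S Q)), (Nat.add_0_r (binom k Q)) by lia.
    simpl; field; split; [apply pow_nonzero|]; easy.
  - replace (S P + 0 + 1)%nat with (S (P + 0 + 1)) by lia.
    rewrite HX', IHP, sum1_first.
    replace (S P + 0 + 2 - 1)%nat with (S (S P)) by lia.
    rewrite Rmult_minus_distr_l, <- sum1_scal.
    unfold Rminus at 1; rewrite Rplus_comm; f_equal; [simpl; field; easy|].
    apply sum1_ext; intros [|k] Hk; [lia|].
    replace (S P + 0 + 2 - S (S k))%nat with (P + 0 + 2 - S k)%nat by lia.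
    replace (S (S k) - 1)%nat with (S k) by lia.
    replace (S k - 1)%nat with k by lia.
    cbn [binom]; rewrite B0, (binom_small k (S P)), (Nat.add_0_r (binom k P)) by lia.
    replace (S P + S (S k))%nat with (S (S (P + S k))) by lia.
    simpl; field; split; [apply pow_nonzero|]; easy.
  - replace (S P + S Q + 1)%nat with (S (P + S Q + 1)) by lia.
    rewrite HX', IHP, IHQ, sum1_first.
    replace (S P + Q + 1)%nat with (P + S Q + 1)%nat by lia.
    rewrite <- sum1_minus, <- sum1_scal.
    (* No exponent reaches 0 in one step, so the term [t = 1] vanishes; the others match by Pascal's
       rule. *)
    match goal with |- _ = ?A + _ => replace A with 0 by (simpl; ring) end.
    rewrite Rplus_0_l; apply sum1_ext; intros [|k] Hk; [lia|].
    replace (S P + S Q + 2 - S (S k))%nat with (P + S Q + 2 - S k)%nat by lia.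
    replace (S P + Q + 2 - S k)%nat with (P + S Q + 2 - S k)%nat by lia.
    replace (S (S k) - 1)%nat with (S k) by lia.
    replace (S k - 1)%nat with k by lia.
    cbn [binom]; rewrite !plus_INR.
    replace (S P + S (S k))%nat with (S (S (P + S k))) by lia.
    replace (S P + S k)%nat with (S (P + S k)) by lia.
    simpl; field; split; [apply pow_nonzero|]; easy.
Qed.

(** The base is an odd integer; the case split is on its sign. *)
Lemma od_shift_sqr (k l : nat) : 1 <= (od k - 2 * INR l) ^ 2.
Proof.
  unfold od; destruct (Nat.le_gt_cases k l) as [H|H]; apply le_INR in H;
    [|rewrite S_INR in H]; nra.
Qed.

Lemma od_shift_neq_0 (k l : nat) : od k - 2 * INR l <> 0.
Proof. pose proof (od_shift_sqr k l); intros E; rewrite E in H; simpl in H; lra. Qed.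

Lemma pow_m1_even (n : nat) : (-1) ^ (2 * n) = 1.
Proof. rewrite pow_mult; replace ((-1) ^ 2) with 1 by ring; apply pow1. Qed.

Lemma pow_opp (x : R) (n : nat) : (- x) ^ n = (-1) ^ n * x ^ n.
Proof. rewrite <- Rpow_mult_distr; f_equal; ring. Qed.

(* Both signs of the shift together, so that the sum over all odd integers of
   either sign becomes a sum over [k >= 1]. *)
Definition shift_sum (l M p q : nat) : R :=
  sum1 (fun k => (-1) ^ k *
    (/ od k ^ p * / (od k - 2 * INR l) ^ q
     - (-1) ^ (p + q) * (/ od k ^ p * / (od k + 2 * INR l) ^ q))) M.

(** The bases differ by [2 l] in one part and by [- 2 l] in the other; the sign [(-1) ^ (p + q)],
    which flips when an exponent drops, compensates. *)
Lemma shift_sum_rec (l M p q : nat) :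
  2 * INR l * shift_sum l M (S p) (S q)
  = shift_sum l M p (S q) - shift_sum l M (S p) q.
Proof.
  unfold shift_sum; rewrite <- sum1_scal, <- sum1_minus.
  apply sum1_ext; intros k Hk.
  pose proof (od_ge_1 k ltac:(lia)); pose proof (od_shift_neq_0 k l) as Hn.
  pose proof (pos_INR l).
  replace (S p + S q)%nat with (S (S (p + q))) by lia.
  replace (p + S q)%nat with (S (p + q)) by lia.
  replace (S p + q)%nat with (S (p + q)) by lia.
  simpl; field; repeat split; try apply pow_nonzero; lra.
Qed.

Lemma inv_pow_lim (u : nat -> R) (q : nat) : (1 <= q)%nat ->
  is_lim_seq (fun n => / u n) 0 -> is_lim_seq (fun n => / u n ^ q) 0.
Proof.
  intros Hq Hu; induction Hq as [|q Hq IH].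
  - apply is_lim_seq_ext with (fun n => / u n); [intros n; rewrite pow_1|]; easy.
  - apply is_lim_seq_ext with (fun n => / u n * / u n ^ q).
    { intros n; rewrite <- Rinv_mult; easy. }
    replace 0 with (0 * 0) by ring; apply is_lim_seq_mult'; easy.
Qed.

Lemma inv_affine_lim (c : R) : is_lim_seq (fun n => / (2 * INR n + c)) 0.
Proof.
  apply (is_lim_seq_inv _ p_infty); [|easy].
  apply is_lim_seq_plus with (l1 := p_infty) (l2 := Finite c);
    [|apply is_lim_seq_const|easy].
  apply is_lim_seq_le_p_loc with INR; [|apply is_lim_seq_INR].
  exists 0%nat; intros n _; pose proof (pos_INR n); lra.
Qed.

Lemma lim_0_pow_m1 (u : nat -> R) :
  is_lim_seq u 0 -> is_lim_seq (fun n => (-1) ^ n * u n) 0.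
Proof.
  intros Hu; apply is_lim_seq_abs_0.
  apply is_lim_seq_ext with (fun n => Rabs (u n)).
  - intros n; rewrite Rabs_mult, pow_1_abs; ring.
  - apply (proj1 (is_lim_seq_abs_0 u)), Hu.
Qed.

(** The alternating test covers the conditionally convergent case [p = 1], which occurs at
    [r = a + b + 1]. *)
Lemma talt1_lim (p : nat) : (1 <= p)%nat ->
  is_lim_seq (sum1 (fun k => (-1) ^ k * / od k ^ p)) (talt [(p, true)]).
Proof.
  intros Hp.
  destruct (ex_lim_alternating (fun k => / od k ^ p)) as [l Hl].
  - intros k Hk; pose proof (od_ge_1 k Hk); pose proof (od_S k); split.
    + left; apply Rinv_0_lt_compat, pow_lt; lra.
    + apply Rinv_le_contravar; [apply pow_lt|apply pow_incr]; lra.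
  - apply inv_pow_lim; [easy|apply inv_od_lim].
  - assert (H : is_lim_seq (talt_trunc [(p, true)]) l).
    { apply is_lim_seq_ext with (2 := Hl); intros n; cbn [talt_trunc].
      apply sum1_ext; intros k Hk; rewrite oddinv_od by lia; simpl; ring. }
    unfold talt; rewrite (is_lim_seq_unique _ _ H); easy.
Qed.

Lemma shift_sum_p_0 (l p : nat) : (1 <= p)%nat ->
  is_lim_seq (fun M => shift_sum l M p 0) ((1 - (-1) ^ p) * talt [(p, true)]).
Proof.
  intros Hp.
  apply is_lim_seq_ext with
    (fun M => (1 - (-1) ^ p) * sum1 (fun k => (-1) ^ k * / od k ^ p) M).
  { intros M; rewrite <- sum1_scal; apply sum1_ext; intros k Hk.
    rewrite Nat.add_0_r; simpl; rewrite Rinv_1; ring. }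
  apply (is_lim_seq_scal_l _ _ (Finite _)), talt1_lim, Hp.
Qed.

Lemma alternating_shift (f : nat -> R) (M : nat) :
  sum1 (fun k => (-1) ^ k * f (S k)) M
  = - sum1 (fun k => (-1) ^ k * f k) M - f 1%nat + (-1) ^ M * f (S M).
Proof. induction M as [|M IH]; simpl; [ring|]; simpl in IH; rewrite IH; ring. Qed.

(** Induction on [l]: moving [k] by one changes the shift by one and reverses the sign, up to terms
    at the end [M] that tend to 0. *)
Lemma shift_sum_0_q (l q : nat) : (1 <= q)%nat ->
  is_lim_seq (fun M => shift_sum l M 0 q)
    ((-1) ^ l * ((1 - (-1) ^ q) * talt [(q, true)])).
Proof.
  intros Hq; induction l as [|l IH].
  - replace ((-1) ^ 0 * ((1 - (-1) ^ q) * talt [(q, true)]))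
      with ((1 - (-1) ^ q) * talt [(q, true)]) by (simpl; ring).
    apply is_lim_seq_ext with
      (fun M => (1 - (-1) ^ q) * sum1 (fun k => (-1) ^ k * / od k ^ q) M).
    { intros M; rewrite <- sum1_scal; apply sum1_ext; intros k Hk.
      simpl (INR 0); rewrite Rmult_0_r, Rminus_0_r, Rplus_0_r; simpl.
      rewrite Rinv_1; ring. }
    apply (is_lim_seq_scal_l _ _ (Finite _)), talt1_lim, Hq.
  - set (f := fun k => / (od k - 2 * INR (S l)) ^ q).
    set (g := fun k => / (od k + 2 * INR l) ^ q).
    assert (E : forall M, shift_sum (S l) M 0 q
      = - 1 * shift_sum l M 0 q + (-1) ^ M * f (S M) - (-1) ^ q * ((-1) ^ M * g (S M))).
    { intros M.
      assert (H0 : shift_sum l M 0 q = sum1 (fun k => (-1) ^ k * f (S k)) M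
                 - (-1) ^ q * sum1 (fun k => (-1) ^ k * g k) M).
      { unfold shift_sum; rewrite <- sum1_scal, <- sum1_minus.
        apply sum1_ext; intros k Hk; unfold f, g; rewrite od_S, S_INR.
        replace (od k + 2 - 2 * (INR l + 1)) with (od k - 2 * INR l) by ring.
        simpl; rewrite Rinv_1; ring. }
      assert (H1 : shift_sum (S l) M 0 q = sum1 (fun k => (-1) ^ k * f k) M
                 - (-1) ^ q * sum1 (fun k => (-1) ^ k * g (S k)) M).
      { unfold shift_sum; rewrite <- sum1_scal, <- sum1_minus.
        apply sum1_ext; intros k Hk; unfold f, g; rewrite od_S, S_INR.
        replace (od k + 2 + 2 * INR l) with (od k + 2 * (INR l + 1)) by ring.
        simpl; rewrite Rinv_1; ring. }
      (* The boundary terms at [k = 1] cancel, since od 1 - 2 (l + 1) = - (od 1 + 2 l). *)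
      assert (H2 : f 1%nat = (-1) ^ q * g 1%nat).
      { unfold f, g, od; rewrite (S_INR l); simpl (INR 1).
        replace (2 * 1 - 1 - 2 * (INR l + 1)) with (- (2 * 1 - 1 + 2 * INR l)) by ring.
        rewrite pow_opp, Rinv_mult; f_equal.
        apply (Rmult_eq_reg_l ((-1) ^ q)); [|apply pow_nonzero; lra].
        rewrite pow_m1_sqr, Rinv_r; [easy|apply pow_nonzero; lra]. }
      rewrite H0, H1, !alternating_shift, H2; ring. }
    apply is_lim_seq_ext with (1 := fun M => eq_sym (E M)).
    replace ((-1) ^ S l * _) with
      (-1 * ((-1) ^ l * ((1 - (-1) ^ q) * talt [(q, true)])) + 0 - (-1) ^ q * 0)
      by (simpl; ring).
    apply is_lim_seq_minus'; [apply is_lim_seq_plus'|].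
    + apply (is_lim_seq_scal_l _ (-1) (Finite _)), IH.
    + apply lim_0_pow_m1, inv_pow_lim; [easy|].
      apply is_lim_seq_ext with (2 := inv_affine_lim (1 - 2 * INR (S l))).
      intros n; f_equal; rewrite od_S; unfold od; ring.
    + apply (is_lim_seq_scal_l _ _ (Finite 0)).
      apply lim_0_pow_m1, inv_pow_lim; [easy|].
      apply is_lim_seq_ext with (2 := inv_affine_lim (1 + 2 * INR l)).
      intros n; f_equal; rewrite od_S; unfold od; ring.
Qed.

Lemma sum1_odd_terms (f : nat -> R) (n : nat) :
  f 1%nat = 0 -> (forall r, (1 <= r <= n)%nat -> f (2 * r)%nat = 0) ->
  sum1 f (2 * n + 1) = sum1 (fun r => f (2 * r + 1)%nat) n.
Proof.
  intros H1 H; induction n as [|n IH]; [simpl; lra|].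
  replace (2 * S n + 1)%nat with (S (S (2 * n + 1))) by lia.
  cbn [sum1]; rewrite IH by (intros r Hr; apply H; lia).
  replace (S (2 * n + 1)) with (2 * S n)%nat by lia; rewrite H by lia.
  replace (2 * S n + 1)%nat with (S (2 * S n)) by lia; ring.
Qed.

(** Here [r] corresponds to [t = 2 * r + 1] in [partial_fraction], and the leading 2 is
    [1 - (-1) ^ i] at the odd exponent [i] of the t-value. *)
Definition row_limit (a b l : nat) : R :=
  sum1 (fun r => 2 * / 2 ^ (2 * r + 1) * talt [(2 * a + 2 * b + 3 - 2 * r, true)%nat] *
    (INR (binom (2 * r) (2 * b + 1)) * / INR l ^ (2 * r + 1)
     - INR (binom (2 * r) (2 * a + 1)) * ((-1) ^ l * / INR l ^ (2 * r + 1))))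
    (a + b + 1).

Lemma shift_sum_lim (a b l : nat) : (1 <= l)%nat ->
  is_lim_seq (fun M => shift_sum l M (2 * a + 2) (2 * b + 2)) (row_limit a b l).
Proof.
  intros Hl; assert (Hl0 : 0 < INR l) by (apply lt_0_INR; lia).
  set (P := (2 * a + 1)%nat); set (Q := (2 * b + 1)%nat).
  set (w := fun i => (1 - (-1) ^ i) * talt [(i, true)]).
  set (F := fun t => / (2 * INR l) ^ t *
    ((-1) ^ S Q * INR (binom (t - 1) Q) * w (P + Q + 2 - t)%nat
     - (-1) ^ (P + t) * INR (binom (t - 1) P) * ((-1) ^ l * w (P + Q + 2 - t)%nat))).
  assert (HF : sum1 F (P + Q + 1) = row_limit a b l).
  { replace (P + Q + 1)%nat with (2 * (a + b + 1) + 1)%nat by (unfold P, Q; lia).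
    (* Both binomials vanish at [t = 1], as [P] and [Q] are at least 1; even [t] leaves an even
       exponent, where [w] is 0. *)
    rewrite sum1_odd_terms.
    - apply sum1_ext; intros r Hr; unfold F, w.
      replace (P + Q + 2 - (2 * r + 1))%nat with (2 * a + 2 * b + 3 - 2 * r)%nat
        by (unfold P, Q; lia).
      replace (2 * r + 1 - 1)%nat with (2 * r)%nat by lia.
      replace (S Q) with (2 * (b + 1))%nat by (unfold Q; lia).
      replace (P + (2 * r + 1))%nat with (2 * (a + r + 1))%nat by (unfold P; lia).
      rewrite !pow_m1_even.
      replace ((-1) ^ (2 * a + 2 * b + 3 - 2 * r)) with (-1).
      + rewrite Rpow_mult_distr, Rinv_mult; unfold P, Q; ring.
      + replace (2 * a + 2 * b + 3 - 2 * r)%nat with (S (2 * (a + b + 1 - r))) by lia.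
        rewrite <- tech_pow_Rmult, pow_m1_even; ring.
    - unfold F, P, Q; rewrite !binom_small by lia; simpl; ring.
    - intros r Hr; unfold F, w.
      replace (P + Q + 2 - 2 * r)%nat with (2 * (a + b + 2 - r))%nat by (unfold P, Q; lia).
      rewrite pow_m1_even; ring. }
  rewrite <- HF.
  replace (2 * a + 2)%nat with (S P) by (unfold P; lia).
  replace (2 * b + 2)%nat with (S Q) by (unfold Q; lia).
  apply is_lim_seq_ext with
    (1 := fun M => eq_sym (partial_fraction (2 * INR l) (shift_sum l M) P Q
             ltac:(lra) (shift_sum_rec l M))).
  (* The range of [t] keeps the exponent [P + Q + 2 - t] at least 1, as both limits need. *)
  apply is_lim_seq_sum1; intros t Ht.
  apply (is_lim_seq_scal_l _ _ (Finite _)), is_lim_seq_minus';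
    apply (is_lim_seq_scal_l _ _ (Finite _)).
  - apply shift_sum_p_0; lia.
  - apply shift_sum_0_q; lia.
Qed.

(** * The series over the shift [l] and its domination *)

Lemma inv_pow_opp_even (x : R) (b : nat) : / (- x) ^ (2 * b + 2) = / x ^ (2 * b + 2).
Proof.
  replace (2 * b + 2)%nat with (2 * (b + 1))%nat by lia.
  rewrite pow_opp, pow_m1_even, Rmult_1_l; easy.
Qed.

(** Induction on [k]: the step moves both progressions by one place, adding the inverse powers of
    [od k] and [od (S k)] and two far terms that tend to 0. The even exponent absorbs the signs of
    the bases. *)
Lemma hsum_lim (b k : nat) : (1 <= k)%nat ->
  is_lim_seq (sum1 (fun l => / (od k - 2 * INR l) ^ (2 * b + 2)
                             - / (od k + 2 * INR l) ^ (2 * b + 2))) (hsum b k).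
Proof.
  set (q := (2 * b + 2)%nat).
  assert (L : forall c, is_lim_seq (fun L => / (2 * INR L + c) ^ q) 0).
  { intros c; apply (inv_pow_lim (fun L => 2 * INR L + c)); [unfold q; lia|].
    apply inv_affine_lim. }
  intros Hk; induction Hk as [|k Hk IH].
  - apply is_lim_seq_ext with (fun L => 1 - / (2 * INR L + 1) ^ q).
    { intros n; induction n as [|n IH].
      - simpl; rewrite Rmult_0_r, Rplus_0_l, pow1; field.
      - cbn [sum1]; rewrite <- IH, S_INR; unfold od; simpl (INR 1).
        replace (2 * 1 - 1 - 2 * (INR n + 1)) with (- (2 * INR n + 1)) by ring.
        unfold q; rewrite inv_pow_opp_even.
        replace (2 * 1 - 1 + 2 * (INR n + 1)) with (2 * (INR n + 1) + 1) by ring; ring. }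
    replace (hsum b 1) with (1 - 0).
    + apply is_lim_seq_minus'; [apply is_lim_seq_const|apply L].
    + unfold hsum, central_sum, od; simpl (sum1 _ _).
      replace (2 * INR 1 - 1) with 1 by (simpl; ring); rewrite pow1; field.
  - replace (hsum b (S k)) with
      (hsum b k + ((/ od k ^ q - 0) + (/ od (S k) ^ q - 0))).
    2: { unfold hsum, central_sum; replace (S k - 1)%nat with k by lia.
         destruct k as [|k]; [lia|]; replace (S k - 1)%nat with k by lia.
         cbn [sum1]; fold q; ring. }
    apply is_lim_seq_ext with (fun L =>
      sum1 (fun l => / (od k - 2 * INR l) ^ q - / (od k + 2 * INR l) ^ q) L
      + ((/ od k ^ q - / (2 * INR L + - od k) ^ q)
         + (/ od (S k) ^ q - / (2 * INR L + od (S k)) ^ q))).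
    { intros n; induction n as [|n IHn].
      - simpl (INR 0); unfold q; rewrite Rmult_0_r, !Rplus_0_l, inv_pow_opp_even; simpl; ring.
      - cbn [sum1]; rewrite <- IHn, od_S, S_INR.
        replace (2 * INR n + - od k) with (- (od k - 2 * INR n)) by ring.
        replace (2 * (INR n + 1) + - od k) with (- (od k - 2 * (INR n + 1))) by ring.
        unfold q; rewrite !inv_pow_opp_even; fold q.
        replace (od k + 2 - 2 * (INR n + 1)) with (od k - 2 * INR n) by ring.
        replace (2 * INR n + (od k + 2)) with (od k + 2 * (INR n + 1)) by ring.
        replace (2 * (INR n + 1) + (od k + 2)) with (od k + 2 + 2 * (INR n + 1)) by ring.
        ring. }
    apply is_lim_seq_plus'; [exact IH|].
    apply is_lim_seq_plus'; apply is_lim_seq_minus'; try apply is_lim_seq_const; apply L.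
Qed.

(** Raising [l] by one prepends [/ od (S l) ^ 2] and drops the last term, so two inverse-square
    sums, each at most 2, bound the sum uniformly in [l] and [M]. *)
Lemma sum1_inv_shift_sqr_le (l M : nat) :
  sum1 (fun k => / (od k - 2 * INR l) ^ 2) M <= 4.
Proof.
  enough (H : sum1 (fun k => / (od k - 2 * INR l) ^ 2) M
              <= sum1 (fun k => / od k ^ 2) M + sum1 (fun k => / od k ^ 2) l).
  { pose proof (sum1_inv_pow_od_le M 2 ltac:(lia)).
    pose proof (sum1_inv_pow_od_le l 2 ltac:(lia)); lra. }
  induction l as [|l IH].
  - simpl (sum1 _ 0); rewrite Rplus_0_r; right; apply sum1_ext; intros k _.
    simpl (INR 0); rewrite Rmult_0_r, Rminus_0_r; easy.
  - cbn [sum1]; eapply Rle_trans; [|rewrite <- Rplus_assoc; apply Rplus_le_compat_r, IH].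
    set (f := fun k => / (od k - 2 * INR (S l)) ^ 2).
    assert (Hf : 0 <= f (S M)).
    { left; apply Rinv_0_lt_compat; pose proof (od_shift_sqr (S M) (S l)); lra. }
    assert (H1 : f 1%nat = / od (S l) ^ 2).
    { unfold f, od; rewrite (S_INR l); simpl (INR 1); f_equal; ring. }
    assert (H2 : sum1 (fun k => / (od k - 2 * INR l) ^ 2) M = sum1 (fun k => f (S k)) M).
    { apply sum1_ext; intros k _; unfold f; rewrite od_S, S_INR; do 2 f_equal; ring. }
    pose proof (sum1_first f M) as H3; cbn [sum1] in H3.
    rewrite H2, <- H1; fold f; lra.
Qed.

Lemma inv_pow_even_le (x : R) (b : nat) : 1 <= x ^ 2 ->
  0 <= / x ^ (2 * b + 2) <= / x ^ 2.
Proof.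
  intros Hx; replace (2 * b + 2)%nat with (2 * S b)%nat by lia.
  rewrite pow_mult; assert (x ^ 2 <= (x ^ 2) ^ S b).
  { rewrite <- (pow_1 (x ^ 2)) at 1; apply Rle_pow; [easy|lia]. }
  split; [left; apply Rinv_0_lt_compat; lra|apply Rinv_le_contravar; lra].
Qed.

(** From (x - y)^2 <= 2 (x^2 + y^2) it follows that x^2 + y^2 >= 2 l^2. *)
Lemma inv_sqr_mul_le (x y l : R) : 1 <= x ^ 2 -> 1 <= y ^ 2 -> 0 < l ->
  4 * l ^ 2 <= (x - y) ^ 2 -> / x ^ 2 * / y ^ 2 <= / l ^ 2 * (/ x ^ 2 + / y ^ 2).
Proof.
  intros Hx Hy Hl H.
  assert (x <> 0) by nra; assert (y <> 0) by nra.
  replace (/ l ^ 2 * (/ x ^ 2 + / y ^ 2))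
    with (/ x ^ 2 * / y ^ 2 * ((x ^ 2 + y ^ 2) / l ^ 2)) by (field; lra).
  rewrite <- (Rmult_1_r (/ x ^ 2 * / y ^ 2)) at 1.
  apply Rmult_le_compat_l.
  - apply Rmult_le_pos; left; apply Rinv_0_lt_compat; lra.
  - apply Rle_div_r; nra.
Qed.

Lemma shift_sum_bound (a b l M : nat) : (1 <= l)%nat ->
  Rabs (shift_sum l M (2 * a + 2) (2 * b + 2)) <= 12 * / INR l ^ 2.
Proof.
  intros Hl; apply (le_INR 1) in Hl; simpl in Hl.
  (* Up to [/ INR l ^ 2], the two products are at most [A' + B'] and [A' + C' <= 2 * A'], whence the
     3. Summation gives 3 * 2 + 4 = 10, within 12. *)
  apply Rle_trans with
    (sum1 (fun k => / INR l ^ 2 * (3 * / od k ^ 2 + / (od k - 2 * INR l) ^ 2)) M).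
  - apply Rabs_sum1_le; intros k Hk.
    rewrite Rabs_mult, pow_1_abs, Rmult_1_l.
    replace (2 * a + 2 + (2 * b + 2))%nat with (2 * (a + b + 2))%nat by lia.
    rewrite pow_m1_even, Rmult_1_l.
    pose proof (od_ge_1 k ltac:(lia)) as Ho.
    assert (H1 : 1 <= od k ^ 2) by nra.
    pose proof (od_shift_sqr k l) as H2.
    assert (H3 : 1 <= (od k + 2 * INR l) ^ 2) by nra.
    assert (H4 : / (od k + 2 * INR l) ^ 2 <= / od k ^ 2) by (apply Rinv_le_contravar; nra).
    pose proof (inv_sqr_mul_le _ _ (INR l) H1 H2 ltac:(lra) ltac:(nra)) as H5.
    pose proof (inv_sqr_mul_le _ _ (INR l) H1 H3 ltac:(lra) ltac:(nra)) as H6.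
    assert (Hi : 0 < / INR l ^ 2) by (apply Rinv_0_lt_compat; nra).
    pose proof (inv_pow_even_le _ a H1); pose proof (inv_pow_even_le _ b H2).
    pose proof (inv_pow_even_le _ b H3).
    set (A := / od k ^ (2 * a + 2)) in *; set (A' := / od k ^ 2) in *.
    set (B := / (od k - 2 * INR l) ^ (2 * b + 2)) in *.
    set (B' := / (od k - 2 * INR l) ^ 2) in *.
    set (C := / (od k + 2 * INR l) ^ (2 * b + 2)) in *.
    set (C' := / (od k + 2 * INR l) ^ 2) in *.
    assert (0 <= A * B <= A' * B')
      by (split; [apply Rmult_le_pos|apply Rmult_le_compat]; lra).
    assert (0 <= A * C <= A' * C')
      by (split; [apply Rmult_le_pos|apply Rmult_le_compat]; lra).
    assert (/ INR l ^ 2 * C' <= / INR l ^ 2 * A') by (apply Rmult_le_compat_l; lra).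
    apply Rabs_le; lra.
  - rewrite sum1_scal, sum1_plus, sum1_scal.
    pose proof (sum1_inv_pow_od_le M 2 ltac:(lia)).
    pose proof (sum1_inv_shift_sqr_le l M).
    assert (Hi : 0 < / INR l ^ 2) by (apply Rinv_0_lt_compat; nra).
    nra.
Qed.

(** The series is twice its even terms minus all terms. The alternating test gives convergence, so
    the partial sums up to [2 * n] suffice to identify the limit. *)
Lemma eta_lim (s : nat) : (2 <= s)%nat ->
  is_lim_seq (sum1 (fun n => (-1) ^ n * / INR n ^ s)) ((2 * / 2 ^ s - 1) * zeta s).
Proof.
  intros Hs.
  destruct (ex_lim_alternating (fun n => / INR n ^ s)) as [l Hl].
  - intros k Hk; rewrite S_INR; apply (le_INR 1) in Hk; simpl in Hk; split.
    + left; apply Rinv_0_lt_compat, pow_lt; lra.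
    + apply Rinv_le_contravar; [apply pow_lt|apply pow_incr]; lra.
  - apply inv_pow_lim; [lia|].
    apply (is_lim_seq_inv _ p_infty); [apply is_lim_seq_INR|easy].
  - replace ((2 * / 2 ^ s - 1) * zeta s) with l; [easy|].
    assert (Hd : forall u (x : R), is_lim_seq u x -> is_lim_seq (fun n => u (2 * n)%nat) x).
    { intros u x Hu; apply (is_lim_seq_subseq u x (fun n => 2 * n)%nat); [|easy].
      apply eventually_subseq; intros n; lia. }
    pose proof (zeta_lim s Hs) as Hz.
    assert (H : is_lim_seq (fun n => sum1 (fun k => (-1) ^ k * / INR k ^ s) (2 * n))
                  (2 * / 2 ^ s * zeta s - zeta s)).
    { apply is_lim_seq_ext with (fun n => 2 * / 2 ^ s * sum1 (fun k => / INR k ^ s) n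
         - sum1 (fun k => / INR k ^ s) (2 * n)).
      - intros n; induction n as [|n IH]; [simpl; ring|].
        replace (2 * S n)%nat with (S (S (2 * n))) by lia.
        cbn [sum1]; rewrite <- IH.
        replace (S (S (2 * n))) with (2 * S n)%nat by lia.
        rewrite <- tech_pow_Rmult, !pow_m1_even, (mult_INR 2 (S n)).
        replace (INR 2) with 2 by (simpl; ring).
        rewrite (Rpow_mult_distr 2), Rinv_mult; ring.
      - apply is_lim_seq_minus'.
        + apply (is_lim_seq_scal_l _ _ (Finite _)), Hz.
        + apply (Hd _ _ Hz). }
    apply Hd in Hl; apply is_lim_seq_unique in H; apply is_lim_seq_unique in Hl.
    rewrite Hl in H; injection H; intros ->; ring.
Qed.

(** * Summation over the shifts and the odd zeta values *)

Definition double_value (a b : nat) : R :=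
  sum1 (fun r => / 2 ^ (2 * r) *
    (INR (binom (2 * r) (2 * a + 1)) * (1 - / 2 ^ (2 * r))
     + INR (binom (2 * r) (2 * b + 1)))
    * zeta (2 * r + 1) * talt [(2 * a + 2 * b + 3 - 2 * r, true)%nat]) (a + b + 1).

(** The sum over [r] is finite and can be taken outside; the unsigned part gives zeta, the signed
    part the factor 1 - 2^(-2r) through [eta_lim]. *)
Lemma row_limit_lim (a b : nat) :
  is_lim_seq (sum1 (row_limit a b)) (double_value a b).
Proof.
  unfold row_limit, double_value.
  apply is_lim_seq_ext with (1 := fun L => eq_sym (sum1_swap _ L (a + b + 1))).
  apply is_lim_seq_sum1; intros r Hr.
  set (t := talt _); set (cb := INR (binom _ (2 * b + 1))).
  set (ca := INR (binom _ (2 * a + 1))).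
  pose proof (zeta_lim (2 * r + 1) ltac:(lia)) as Hz.
  pose proof (eta_lim (2 * r + 1) ltac:(lia)) as He.
  apply is_lim_seq_ext with (fun L => 2 * / 2 ^ (2 * r + 1) * t *
    (cb * sum1 (fun l => / INR l ^ (2 * r + 1)) L
     - ca * sum1 (fun l => (-1) ^ l * / INR l ^ (2 * r + 1)) L)).
  { intros L; rewrite <- !sum1_scal, <- sum1_minus, <- sum1_scal; easy. }
  replace (/ 2 ^ (2 * r) * (ca * (1 - / 2 ^ (2 * r)) + cb) * zeta (2 * r + 1) * t)
    with (2 * / 2 ^ (2 * r + 1) * t * (cb * zeta (2 * r + 1)
      - ca * ((2 * / 2 ^ (2 * r + 1) - 1) * zeta (2 * r + 1)))).
  - apply (is_lim_seq_scal_l _ _ (Finite _)), is_lim_seq_minus';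
      apply (is_lim_seq_scal_l _ _ (Finite _)); easy.
  - rewrite pow_add, pow_1, Rinv_mult.
    assert (E : 2 * (/ 2 ^ (2 * r) * / 2) = / 2 ^ (2 * r)) by (field; apply pow_nonzero; lra).
    rewrite E; ring.
Qed.

(** Rows are indexed by the cutoff [M] in [k], columns by [l]. Summing a row over [l] gives the
    partial sum in [k] by [hsum_lim], so the exchange yields convergence and value together. *)
Lemma double_sum_lim (a b : nat) :
  is_lim_seq (sum1 (fun k => (-1) ^ k * / od k ^ (2 * a + 2) * hsum b k))
    (double_value a b).
Proof.
  apply (lim_sum1_exchange (fun M l => shift_sum l M (2 * a + 2) (2 * b + 2))
           (row_limit a b)).
  - apply dominated_uniform_tails with (fun l => 12 * / INR l ^ 2).
    + exists (12 * zeta 2).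
      apply is_lim_seq_ext with (fun n => 12 * sum1 (fun k => / INR k ^ 2) n).
      { intros n; rewrite sum1_scal; easy. }
      apply (is_lim_seq_scal_l _ 12 (Finite _)), zeta_lim; lia.
    + intros M l Hl; apply shift_sum_bound, Hl.
  - intros l Hl; apply shift_sum_lim, Hl.
  - intros M; unfold shift_sum.
    apply is_lim_seq_ext with (1 := fun L => eq_sym (sum1_swap _ L M)).
    apply is_lim_seq_sum1; intros k Hk.
    apply is_lim_seq_ext with (fun L => (-1) ^ k * / od k ^ (2 * a + 2) *
      sum1 (fun l => / (od k - 2 * INR l) ^ (2 * b + 2)
                     - / (od k + 2 * INR l) ^ (2 * b + 2)) L).
    { intros L; rewrite <- sum1_scal; apply sum1_ext; intros l _.
      replace (2 * a + 2 + (2 * b + 2))%nat with (2 * (a + b + 2))%nat by lia.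
      rewrite pow_m1_even; ring. }
    apply (is_lim_seq_scal_l _ _ (Finite _)), hsum_lim; lia.
  - apply row_limit_lim.
Qed.

(** The double series converges because its partial sums are half the difference of two convergent
    ones. *)
Lemma talt_double_value (a b : nat) :
  talt [(2 * a + 2 * b + 4, true)%nat]
  + 2 * talt [(2 * a + 2, true); (2 * b + 2, false)]%nat = double_value a b.
Proof.
  pose proof (talt1_lim (2 * a + 2 * b + 4) ltac:(lia)) as H1.
  set (t1 := talt [(2 * a + 2 * b + 4, true)%nat]) in *.
  assert (H2 : is_lim_seq (talt_trunc [(2 * a + 2, true); (2 * b + 2, false)]%nat)
                 (/ 2 * (double_value a b - t1))).
  { apply is_lim_seq_ext with (2 := is_lim_seq_scal_l _ (/ 2) _
      (is_lim_seq_minus' _ _ _ _ (double_sum_lim a b) H1)).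
    intros n; rewrite <- sum1_minus, <- sum1_scal; apply sum1_ext; intros k Hk.
    rewrite oddinv_od by lia.
    assert (E : sum1 (fun j => 1 * oddinv j (2 * b + 2) * 1) (k - 1)
                = sum1 (fun j => / od j ^ (2 * b + 2)) (k - 1)).
    { apply sum1_ext; intros j Hj; rewrite oddinv_od by lia; ring. }
    cbn [talt_trunc sgn]; rewrite E; unfold hsum, central_sum.
    replace (2 * a + 2 * b + 4)%nat with ((2 * a + 2) + (2 * b + 2))%nat by lia.
    rewrite (pow_add (od k) (2 * a + 2) (2 * b + 2)), Rinv_mult; lra. }
  unfold talt at 1; rewrite (is_lim_seq_unique _ _ H2); cbn [real]; field.
Qed.

Theorem theorem4p2 (a b : nat) :
  tstar (repeat 2%nat a ++ 3%nat :: repeat 2%nat b)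
    = - (4 / PI) * talt [(2 * a + 2 * b + 4, true)%nat]
      - (8 / PI) * talt [(2 * a + 2, true); (2 * b + 2, false)]%nat
  /\
  - (4 / PI) * talt [(2 * a + 2 * b + 4, true)%nat]
      - (8 / PI) * talt [(2 * a + 2, true); (2 * b + 2, false)]%nat
    = - (4 / PI) *
      sum1 (fun r =>
              / 2 ^ (2 * r) *
              (INR (binom (2 * r) (2 * a + 1)) * (1 - / 2 ^ (2 * r))
               + INR (binom (2 * r) (2 * b + 1)))
              * zeta (2 * r + 1)
              * talt [(2 * a + 2 * b + 3 - 2 * r, true)%nat])
        (a + b + 1).
Proof.
  fold (double_value a b).
  rewrite (tstar_lim a b _ (double_sum_lim a b)), <- (talt_double_value a b).
  pose proof PI_neq0; split; field; easy.
Qed.
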